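(* Let $\mathcal{S}$ be a b0-space such that $\Lambda^{\mathfrak f}\mathcal{O}(\mathcal{S})=\mathcal{O}(\mathcal{S})$ and let $\mathcal{T}$ be an arbitrary b0-space. Let $f\colon\mathcal{S}\to\mathcal{T}$ be a basic continuous map with basic preimage $f_{\leftarrow}$. Then $f$ is a basic open map if and only if the map $f_{\leftarrow}^{\,\mathfrak{f}\mathfrak{o}}\colon\mathcal{O}^{\mathfrak f}(\mathcal{T})\to\mathcal{O}^{\mathfrak f}(\mathcal{S})$, $V\mapsto f_{\leftarrow}[V]$, has a left adjoint $h\colon\mathcal{O}^{\mathfrak f}(\mathcal{S})\to\mathcal{O}^{\mathfrak f}(\mathcal{T})$ such that the following conditions hold: (1) For every $U\in\mathcal{O}(\mathcal{S})$, $h[U]\in\mathcal{O}(\mathcal{T})$. (2) For every $U\in\mathcal{O}(\mathcal{S})$ and all $V_1,\dots,V_n\in\mathcal{O}(\mathcal{T})$, $h[U\cap f_{\leftarrow}[V_1\cap\dots\cap V_n]]=h[U]\cap V_1\cap\dots\cap V_n$.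
   Context: A closure system on a set $X$ is a family of subsets of $X$ containing $X$ and closed under arbitrary intersections; ordered by inclusion it is a complete lattice whose meets are intersections and whose joins $\vee$ are the least members containing the union. A basic zero-dimensional space (b0-space) is a triple $\mathcal{S}=(X,\mathcal{C},\mathcal{B}d)$ where $X$ is a set, $\mathcal{B}d$ is a closure system on $X$ that is distributive as a lattice, and $\mathcal{C}\subseteq\mathcal{B}d$ is such that every $C\in\mathcal{C}$ has a complement $\neg C$ in the lattice $\mathcal{B}d$, and every $M\in\mathcal{B}d$ is of the form $M=\bigcap_{i\in J}(C_i^1\vee\neg D_i^1\vee\dots\vee C_i^{n_i}\vee\neg D_i^{n_i})$ with all $C_i^k,D_i^k\in\mathcal{C}$ (finite joins in $\mathcal{B}d$, the empty join being allowed). Write $|\mathcal{S}|=X$, $\mathcal{C}(\mathcal{S})=\mathcal{C}$, $\mathcal{B}d(\mathcal{S})=\mathcal{B}d$, and $\mathcal{O}(\mathcal{S})=\{\neg C\mid C\in\mathcal{C}\}$ (the open domains); the bottom element of $\mathcal{B}d$ is denoted $\mathsf{O}$ (same symbol for every b0-space). A basic continuous map $f\colon\mathcal{S}\to\mathcal{T}$ between b0-spaces is a map $f\colon|\mathcal{S}|\to|\mathcal{T}|$ such that: (BC1) $f^{-1}[\mathsf{O}]=\mathsf{O}$; (BC2) there is a map $f_{\leftarrow}^{\mathfrak{c}}\colon\mathcal{C}(\mathcal{T})\to\mathcal{C}(\mathcal{S})$ such that $f[B]\subseteq C$ iff $B\subseteq f_{\leftarrow}^{\mathfrak{c}}[C]$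 for all $B\in\mathcal{C}(\mathcal{S})$, $C\in\mathcal{C}(\mathcal{T})$ (this map is then unique); (BC3) $\neg f_{\leftarrow}^{\mathfrak{c}}[C]\subseteq f^{-1}[\neg C]$ for all $C\in\mathcal{C}(\mathcal{T})$; (BC4) $\bigvee_{i=1}^n(f_{\leftarrow}^{\mathfrak{c}}[C_i]\vee\neg f_{\leftarrow}^{\mathfrak{c}}[D_i])\subseteq f^{-1}[\bigvee_{i=1}^n(C_i\vee\neg D_i)]$ for all $n$ and all $C_i,D_i\in\mathcal{C}(\mathcal{T})$. For a basic continuous $f$, the basic image is $f_{\rightarrow}\colon\mathcal{B}d(\mathcal{S})\to\mathcal{B}d(\mathcal{T})$, $f_{\rightarrow}[M]=\bigcap\{S\in\mathcal{B}d(\mathcal{T})\mid f[M]\subseteq S\}$; it has a right adjoint $f_{\leftarrow}\colon\mathcal{B}d(\mathcal{T})\to\mathcal{B}d(\mathcal{S})$ (so $f_{\rightarrow}[M]\subseteq K$ iff $M\subseteq f_{\leftarrow}[K]$), called the basic preimage of $f$. A basic continuous map $f$ is a basic open map if $f_{\rightarrow}[U]\in\mathcal{O}(\mathcal{T})$ for every $U\in\mathcal{O}(\mathcal{S})$. For $\mathcal{X}\subseteq\mathcal{B}d(\mathcal{S})$, $\Lambda^{\mathfrak f}\mathcal{X}$ denotes the set of all finite meets (intersections), including the empty one $|\mathcal{S}|$, of elements of $\mathcal{X}$. The set $\mathcal{O}^{\mathfrak f}(\mathcal{S})$ of finitely generated open domains consists of all finite joins in $\mathcal{B}d(\mathcal{S})$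 (including the empty join $\mathsf{O}$) of elements of $\Lambda^{\mathfrak f}\mathcal{O}(\mathcal{S})$; it is ordered by inclusion. Since $f_{\leftarrow}$ sends open domains to open domains and preserves finite joins and finite meets, $f_{\leftarrow}^{\,\mathfrak{f}\mathfrak{o}}$ is well defined. *)

(* Defs.v *)
From mathcomp Require Import all_boot.
From mathcomp Require Export boolp classical_sets.

Set Implicit Arguments.
Unset Strict Implicit.
Unset Printing Implicit Defensive.

Local Open Scope classical_set_scope.

Section Lattice.
Context {X : Type}.
Implicit Types (Bd F : set (set X)) (A B C N : set X).

(* The empty subfamily is allowed, so that [Bd setT] is in fact a special
   case of the second clause. *)
Definition closure_system Bd : Prop :=
  Bd [set: X] /\ forall F, F `<=` Bd -> Bd (\bigcap_(A in F) A).

(* [smallest Bd A] is the intersection of all members of [Bd] containing [A],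
   i.e. the closure of [A]. *)
Definition bottom Bd : set X := smallest Bd set0.

Definition join2 Bd A B : set X := smallest Bd (A `|` B).

Definition joinn Bd (n : nat) (A : 'I_n -> set X) : set X :=
  smallest Bd (\bigcup_(k in [set: 'I_n]) A k).

Definition meetn (n : nat) (A : 'I_n -> set X) : set X :=
  \bigcap_(k in [set: 'I_n]) A k.

Definition distributive_lattice Bd : Prop :=
  forall A B C, Bd A -> Bd B -> Bd C ->
    A `&` join2 Bd B C = join2 Bd (A `&` B) (A `&` C).

Definition is_complement Bd C N : Prop :=
  [/\ Bd N, C `&` N = bottom Bd & join2 Bd C N = [set: X]].

(* Complements are unique in a distributive lattice; the default value set0 is
   only taken when [C] has no complement. *)
Definition neg Bd C : set X := xget set0 [set N | is_complement Bd C N].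

Definition finite_meets F : set (set X) :=
  [set A | exists n (U : 'I_n -> set X), (forall k, F (U k)) /\ A = meetn U].

Definition finite_joins Bd F : set (set X) :=
  [set A | exists n (U : 'I_n -> set X), (forall k, F (U k)) /\ A = joinn Bd U].

(* C^1 \/ ~D^1 \/ ... \/ C^n \/ ~D^n *)
Definition clause Bd (n : nat) (C D : 'I_n -> set X) : set X :=
  joinn Bd (fun k => join2 Bd (C k) (neg Bd (D k))).

End Lattice.

Record b0space := B0Space {
  carrier :> Type;
  Cl : set (set carrier);
  Bd : set (set carrier);
  Bd_closure_system : closure_system Bd;
  Bd_distributive : distributive_lattice Bd;
  Cl_sub_Bd : Cl `<=` Bd;
  Cl_complemented : forall C, Cl C -> exists N, is_complement Bd C N;
  Bd_generated : forall M, Bd M ->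
    exists (J : Type) (n : J -> nat) (C D : forall i : J, 'I_(n i) -> set carrier),
      (forall i k, Cl (C i k) /\ Cl (D i k)) /\
      M = \bigcap_(i in [set: J]) clause Bd (C i) (D i)
}.

Definition opens (S : b0space) : set (set S) :=
  [set neg (@Bd S) C | C in @Cl S].

Definition fg_opens (S : b0space) : set (set S) :=
  finite_joins (@Bd S) (finite_meets (@opens S)).

(* Adjunction between the posets [P] and [Q], ordered by inclusion. The maps
   are total functions on subsets; only their values on [P] and [Q] matter. *)
Definition adjoint {X Y : Type} (P : set (set X)) (Q : set (set Y))
    (l : set X -> set Y) (r : set Y -> set X) : Prop :=
  [/\ forall A, P A -> Q (l A),
      forall B, Q B -> P (r B) &
      forall A B, P A -> Q B -> (l A `<=` B <-> A `<=` r B)].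

Section Maps.
Context {S T : b0space}.
Implicit Types (f : S -> T) (g : set T -> set S).

Definition BC1 f : Prop := f @^-1` bottom (@Bd T) = bottom (@Bd S).

Definition BC2 f g : Prop :=
  (forall C, Cl C -> Cl (g C)) /\
  (forall B C, Cl B -> Cl C -> (f @` B `<=` C <-> B `<=` g C)).

Definition BC3 f g : Prop :=
  forall C, Cl C -> neg (@Bd S) (g C) `<=` f @^-1` neg (@Bd T) C.

Definition BC4 f g : Prop :=
  forall n (C D : 'I_n -> set T), (forall k, Cl (C k) /\ Cl (D k)) ->
    clause (@Bd S) (g \o C) (g \o D) `<=` f @^-1` clause (@Bd T) C D.

(* [BC2 f] determines [g] on [Cl]. *)
Definition basic_continuous f : Prop :=
  BC1 f /\ exists g, [/\ BC2 f g, BC3 f g & BC4 f g].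

Definition basic_image f (M : set S) : set T := smallest (@Bd T) (f @` M).

(* The right adjoint of [basic_image f]; it is unique on [Bd], and it exists
   when [f] is basic continuous ([basic_preimageP]). *)
Definition basic_preimage f : set T -> set S :=
  xget (fun=> set0) [set r | adjoint (@Bd S) (@Bd T) (basic_image f) r].

Definition basic_open f : Prop :=
  basic_continuous f /\ forall U, opens U -> opens (basic_image f U).

End Maps.

Section LatticeFacts.
Context {X : Type} {Bd : set (set X)}.
Hypotheses (csBd : closure_system Bd) (dBd : distributive_lattice Bd).

Lemma Bd_smallest A : Bd (smallest Bd A).
Proof. by apply: csBd.2 => M []. Qed.

Lemma Bd_bigcap (J : Type) (A : J -> set X) :
  (forall i, Bd (A i)) -> Bd (\bigcap_(i in [set: J]) A i).
Proof.
move=> BdA; rewrite -(bigcap_image setT A id).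
by apply: csBd.2 => _ [i _ <-].
Qed.

Lemma Bd_setI A B : Bd A -> Bd B -> Bd (A `&` B).
Proof.
move=> BdA BdB; rewrite -bigcap2E /bigcap2.
apply: Bd_bigcap => -[|[|i]] //=; exact: csBd.1.
Qed.

Lemma sub_join2 A B W : Bd W -> A `<=` W -> B `<=` W -> join2 Bd A B `<=` W.
Proof. by move=> BdW AW BW; apply: smallest_sub => // x [/AW|/BW]. Qed.

Lemma bottom_sub W : Bd W -> bottom Bd `<=` W.
Proof. by move=> BdW; apply: smallest_sub. Qed.

Lemma sub_split A B M W : Bd A -> Bd B -> Bd M -> Bd W ->
  join2 Bd A B = setT -> M `&` A `<=` W -> M `&` B `<=` W -> M `<=` W.
Proof.
move=> BdA BdB BdM BdW AB MA MB.
by rewrite -[M]setIT -AB dBd//; apply: sub_join2.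
Qed.

Lemma negP C : (exists N, is_complement Bd C N) -> is_complement Bd C (neg Bd C).
Proof. exact: xgetPex. Qed.

Lemma joinn_meet0 n (A : 'I_n -> set X) (G W : set X) : Bd G -> Bd W ->
  (forall k, Bd (A k)) -> (forall k, G `&` A k `<=` W) ->
  G `&` joinn Bd A `<=` W.
Proof.
move=> BdG BdW BdA GA.
suff H (s : seq 'I_n) : G `&` smallest Bd (\bigcup_(k in [set` s]) A k) `<=` W.
  apply: subset_trans (H (enum 'I_n)); apply: setIS; apply: smallest_sub.
    exact: Bd_smallest.
  move=> x [k _ Akx]; apply: sub_gen_smallest; exists k => //=.
  by rewrite mem_enum.
elim: s => [|k s IH].
  apply: (subset_trans (@subIsetr _ _ _)); apply: smallest_sub => // x [j /=].
  by rewrite in_nil.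
apply: (@subset_trans _
  (G `&` join2 Bd (A k) (smallest Bd (\bigcup_(k in [set` s]) A k)))).
  apply: setIS; apply: smallest_sub; first exact: Bd_smallest.
  move=> x [j /=]; rewrite inE => /orP[/eqP->|js] Ax; apply: sub_gen_smallest.
    by left.
  by right; apply: sub_gen_smallest; exists j.
by rewrite dBd//; [apply: sub_join2|exact: Bd_smallest].
Qed.

End LatticeFacts.

Lemma basic_preimageP (S T : b0space) (f : S -> T) : basic_continuous f ->
  adjoint (@Bd S) (@Bd T) (basic_image f) (basic_preimage f).
Proof.
move=> [bc1 [g [[gCl gadj] bc3 bc4]]].
have csS := @Bd_closure_system S; have csT := @Bd_closure_system T.
have dS := @Bd_distributive S; have dT := @Bd_distributive T.
have negS C (h : Cl C) := negP (@Cl_complemented S C h).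
have negT C (h : Cl C) := negP (@Cl_complemented T C h).
have clS n (C D : 'I_n -> set T) (M : set S) :
    (forall k, Cl (C k) /\ Cl (D k)) -> Bd M ->
    M `<=` f @^-1` clause (@Bd T) C D ->
    M `<=` clause (@Bd S) (g \o C) (g \o D).
  move=> CD BdM Mf; set W := clause _ _ _.
  have BdW : Bd W by exact: Bd_smallest.
  have CW k : g (C k) `<=` W.
    move=> x gx; apply: sub_gen_smallest; exists k => //.
    by apply: sub_gen_smallest; left.
  have DW k : neg (@Bd S) (g (D k)) `<=` W.
    move=> x gx; apply: sub_gen_smallest; exists k => //.
    by apply: sub_gen_smallest; right.
  pose F k := neg (@Bd S) (g (C k)) `&` g (D k).
  have split (s : seq 'I_n) : forall N, Bd N ->
      N `&` \bigcap_(k in [set` s]) F k `<=` W -> N `<=` W.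
    elim: s => [|k s IH] N BdN.
      by apply: subset_trans => x Nx; split=> // j /=; rewrite in_nil.
    move=> NW.
    have [Bn _ En] := negS _ (gCl _ (CD k).1).
    have [Bn' _ En'] := negS _ (gCl _ (CD k).2).
    have Bgc := Cl_sub_Bd (gCl _ (CD k).1).
    have Bgd := Cl_sub_Bd (gCl _ (CD k).2).
    apply: (sub_split dS Bgc Bn BdN BdW En).
      by apply: subset_trans (CW k); exact: subIsetr.
    apply: (sub_split dS Bgd Bn' _ BdW En').
    - exact: Bd_setI.
    - rewrite -setIA; apply: IH; first by apply: Bd_setI => //; exact: Bd_setI.
      move=> x [[Nx Fx] Hx]; apply: NW; split=> // j /=.
      by rewrite inE => /orP[/eqP->|js]; [|exact: Hx].
    - by apply: subset_trans (DW k); exact: subIsetr.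
  apply: (split (enum 'I_n)) => // x [Mx Fx].
  apply: (bottom_sub BdW); rewrite -bc1 /preimage /=.
  pose G := \bigcap_(k in [set: 'I_n]) (neg (@Bd T) (C k) `&` D k).
  apply: (@joinn_meet0 _ _ csT dT n
    (fun k => join2 (@Bd T) (C k) (neg (@Bd T) (D k))) G _ _ _ _ _ (f x)).
  - apply: Bd_bigcap => // k; have [Bn _ _] := negT _ (CD k).1.
    by apply: Bd_setI => //; exact: Cl_sub_Bd (CD k).2.
  - exact: Bd_smallest.
  - by move=> k; exact: Bd_smallest.
  - move=> k; have [Bn E1 _] := negT _ (CD k).1.
    have [Bn' E2 _] := negT _ (CD k).2.
    have BC := Cl_sub_Bd (CD k).1; have BD := Cl_sub_Bd (CD k).2.
    apply: (@subset_trans _ ((neg (@Bd T) (C k) `&` D k) `&`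
        join2 (@Bd T) (C k) (neg (@Bd T) (D k)))).
      by apply: setSI; exact: bigcap_inf.
    rewrite dT//; last exact: Bd_setI.
    apply: sub_join2; first exact: Bd_smallest.
      by move=> y [[ny _] Cy]; rewrite -E1.
    by move=> y [[_ Dy] ny]; rewrite -E2.
  split; last exact: Mf.
  move=> k _; have [|nx gx] := Fx k; first by rewrite /= mem_enum.
  split; first exact: bc3 (CD k).1 _ nx.
  by apply: ((gadj _ _ (gCl _ (CD k).2) (CD k).2).2 (fun _ h => h)); exists x.
suff [r rP] : exists r, adjoint (@Bd S) (@Bd T) (basic_image f) r.
  by apply: (xgetPex (fun=> set0)); exists r.
have ex (K : set T) : exists N : set S, Bd K ->
    Bd N /\ forall M, Bd M -> (M `<=` f @^-1` K <-> M `<=` N).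
  have [BdK|] := pselect (Bd K); last by exists set0.
  have [J [n [C [D [CD ->]]]]] := Bd_generated BdK.
  exists (\bigcap_(i in [set: J]) clause (@Bd S) (g \o C i) (g \o D i)) => _.
  split; first by apply: Bd_bigcap => // i; exact: Bd_smallest.
  move=> M BdM; split=> H x Mx i _.
    by apply: (clS _ _ _ _ (CD i) BdM) => // y My; exact: (H y My i).
  exact: (bc4 _ _ _ (CD i) _ (H _ Mx i I)).
exists (fun K => projT1 (cid (ex K))); split.
- by move=> A _; exact: Bd_smallest.
- by move=> B BdB; have [] := projT2 (cid (ex B)) BdB.
- move=> A B BdA BdB; have [_ H] := projT2 (cid (ex B)) BdB.
  rewrite -H//; split=> h x.
    by move=> Ax; apply: h; apply: sub_gen_smallest; exists x.
  by apply: smallest_sub => // _ [y Ay <-]; exact: h.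
Qed.

(* Main.v *)
Require Import Defs.
From mathcomp Require Import all_boot.
From mathcomp Require Import boolp classical_sets.

Set Implicit Arguments.
Unset Strict Implicit.

Local Open Scope classical_set_scope.

(** Write [f_*] for the basic image and [f^*] for the basic preimage, so that
[f_*] is left adjoint to [f^*] on all of [Bd].  Everything rests on a
supply of sets [V] of the target that [f] separates: [V] has a disjoint partner
[V'] such that [f^* V] and [f^* V'] still cover the source.  By BC1, BC2 and
BC3 every open domain is separated, with partner the [C] it is the complement of
([separated_neg]), and by distributivity so is every finite meet of open domains
([separated_meetn]).  Separation lets statements be transported through [f^*]
by cases.  It yields that [f^*] preserves finite joins of separated sets
([preimage_joinn]), hence restricts to finitely generated open domains
([preimage_fg_opens]), and the Frobenius law [f_* (U & f^* V) = f_* U & V]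
([basic_image_frobenius]).

If [f] is basic open, then [h := f_*] works: it preserves joins, and since open
domains of the source are closed under finite meets, each finitely generated
open domain of the source is a finite join of open domains; condition (2) is the
Frobenius law.

Conversely, let [h] be the given adjoint and [U] an open domain.  Then
[h U = f_* U] ([left_adjoint_image]), which is open by (1).  The unit of the
adjunction gives [f_* U] below [h U].  For the other inclusion it is enough to
test against one generating clause, the join of all [C_i] and all [neg D_i].  If
[U] is below [f^*] of the clause, then [U & f^* (/\_i neg C_i)], again an open
domain, is below [f^*] of the finitely generated open domain [\/_i neg D_i].
The adjunction followed by (2) turns this into
[h U & /\_i neg C_i] being below [\/_i neg D_i], and distributivity moves the
[C_i] back to the right-hand side. *)

(** * Closure systems *)

Section ClosureSystem.
Context {X : Type} {Bd : set (set X)}.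
Hypotheses (csBd : closure_system Bd) (dBd : distributive_lattice Bd).

Lemma sub_joinn n (A : 'I_n -> set X) k : A k `<=` joinn Bd A.
Proof. by move=> x Ax; apply: sub_gen_smallest; exists k. Qed.

Lemma joinn_sub n (A : 'I_n -> set X) W :
  Bd W -> (forall k, A k `<=` W) -> joinn Bd A `<=` W.
Proof. by move=> BdW AW; apply: smallest_sub => // x [k _ /AW]. Qed.

Lemma meet_join2_sub G A B W : Bd G -> Bd A -> Bd B -> Bd W ->
  G `&` A `<=` W -> G `&` B `<=` W -> G `&` join2 Bd A B `<=` W.
Proof. by move=> *; rewrite dBd//; apply: sub_join2. Qed.

(** Case distinction on [n] covers at once; it replaces the de Morgan identity
    that the meet of the [A k] and the join of the [B k] cover. *)
Lemma sub_splitn n (A B : 'I_n -> set X) M W :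
  (forall k, [/\ Bd (A k), Bd (B k) & join2 Bd (A k) (B k) = setT]) ->
  Bd M -> Bd W -> M `&` meetn A `<=` W -> (forall k, M `&` B k `<=` W) ->
  M `<=` W.
Proof.
elim: n A B M => [|n IH] A B M AB BdM BdW MA MB.
  by apply: subset_trans MA => x Mx; split=> // -[].
have [BdA BdB AB0] := AB ord0.
apply: (sub_split dBd BdA BdB BdM BdW AB0) => //.
apply: (IH (A \o lift ord0) (B \o lift ord0)) => //.
- by move=> k; exact: AB.
- exact: Bd_setI.
- move=> x [[Mx Ax] Ax']; apply: MA; split=> // k _.
  by case: (unliftP ord0 k) => [j|] ->; [exact: Ax'|].
- by move=> k x [[Mx _] Bx]; apply: MB; split=> //; exact: Bx.
Qed.

Lemma finite_joins_incl (F : set (set X)) :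
  F `<=` Bd -> F `<=` finite_joins Bd F.
Proof.
move=> FBd A FA; exists 1, (fun=> A); split=> //; apply/seteqP; split.
  exact: (sub_joinn (A := fun _ : 'I_1 => A) (k := ord0)).
by apply: joinn_sub => [|_] //; exact: FBd.
Qed.

End ClosureSystem.

Lemma finite_meets_incl (X : Type) (F : set (set X)) : F `<=` finite_meets F.
Proof.
move=> A FA; exists 1, (fun=> A); split=> //.
by apply/seteqP; split=> [x Ax k _|x /(_ ord0 I)].
Qed.

Lemma finite_meets_setI (X : Type) (F : set (set X)) A B :
  F A -> F B -> finite_meets F (A `&` B).
Proof.
move=> FA FB; exists 2, (fun k => if k == ord0 then A else B); split.
  by move=> k; case: ifP.
apply/seteqP; split=> [x [Ax Bx] k _|x ABx]; first by case: ifP.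
by split; [exact: (ABx ord0 I)|exact: (ABx (lift ord0 ord0) I)].
Qed.

(** * Open domains *)

Section Opens.
Context {S : b0space}.
Let csS := @Bd_closure_system S.

Lemma neg_complement C : Cl C -> is_complement (@Bd S) C (neg (@Bd S) C).
Proof. by move=> CC; apply: Defs.negP; exact: Cl_complemented CC. Qed.

Lemma opens_Bd : @opens S `<=` @Bd S.
Proof. by move=> _ [C CC <-]; have [] := neg_complement CC. Qed.

Lemma finite_meets_opens_Bd : finite_meets (@opens S) `<=` @Bd S.
Proof.
move=> _ [n [U [oU ->]]]; apply: Bd_bigcap => // k.
exact/opens_Bd/oU.
Qed.

Lemma fg_opens_Bd : @fg_opens S `<=` @Bd S.
Proof. by move=> _ [n [U [oU ->]]]; exact: Bd_smallest. Qed.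

Lemma opens_fg_opens : @opens S `<=` @fg_opens S.
Proof.
move=> U oU; apply: finite_joins_incl; first exact: finite_meets_opens_Bd.
exact: finite_meets_incl.
Qed.

Lemma joinn_opens_fg_opens n (U : 'I_n -> set S) :
  (forall k, opens (U k)) -> fg_opens (joinn (@Bd S) U).
Proof.
by move=> oU; exists n, U; split=> // k; exact/finite_meets_incl/oU.
Qed.

End Opens.

(** * The basic preimage *)

Section Preimage.
Context {S T : b0space} {f : S -> T}.
Hypothesis bcf : basic_continuous f.
Let csS := @Bd_closure_system S.
Let csT := @Bd_closure_system T.
Let dS := @Bd_distributive S.
Let dT := @Bd_distributive T.
Local Notation pre := (basic_preimage f).

Lemma Bd_preimage K : Bd K -> Bd (pre K).
Proof. by have [_ + _] := basic_preimageP bcf; exact. Qed.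

Lemma image_sub_preimage M K :
  Bd M -> Bd K -> basic_image f M `<=` K <-> M `<=` pre K.
Proof. by have [_ _] := basic_preimageP bcf; exact. Qed.

Lemma sub_preimageP M K : Bd M -> Bd K -> M `<=` pre K <-> M `<=` f @^-1` K.
Proof.
move=> BdM BdK; rewrite -image_sub_preimage//; split=> MK.
  by move=> x Mx; apply: MK; apply: sub_gen_smallest; exists x.
by apply: smallest_sub => // _ [x Mx <-]; exact: MK.
Qed.

Lemma preimage_sub K : Bd K -> pre K `<=` f @^-1` K.
Proof. by move=> BdK; apply/sub_preimageP => //; exact: Bd_preimage. Qed.

Lemma preimageS K L : Bd K -> Bd L -> K `<=` L -> pre K `<=` pre L.
Proof.
move=> BdK BdL KL; apply/sub_preimageP => //; first exact: Bd_preimage.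
by move=> x /(preimage_sub BdK)/KL.
Qed.

Lemma preimage_meetn n (V : 'I_n -> set T) :
  (forall k, Bd (V k)) -> pre (meetn V) = meetn (pre \o V).
Proof.
move=> BdV; have BdM : Bd (meetn V) by exact: Bd_bigcap.
have BdP k : Bd (pre (V k)) by exact: Bd_preimage.
apply/seteqP; split=> [x Mx k _|].
  by apply: (preimageS BdM (BdV k)) Mx => y; exact.
apply/sub_preimageP => //; first exact: Bd_bigcap.
by move=> x Mx k _; apply: preimage_sub => //; exact: Mx k I.
Qed.

Lemma preimage_bottom_sub : f @^-1` bottom (@Bd T) `<=` bottom (@Bd S).
Proof. by have [-> _] := bcf. Qed.

Lemma preimage_disjoint K K' W : Bd K -> Bd K' -> Bd W ->
  K `&` K' `<=` bottom (@Bd T) -> pre K `&` pre K' `<=` W.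
Proof.
move=> BdK BdK' BdW KK' x [/(preimage_sub BdK) Kx /(preimage_sub BdK') K'x].
by apply: (bottom_sub BdW); apply: preimage_bottom_sub; exact: KK'.
Qed.

(** The adjoint map on [Cl] given by BC2 agrees with the basic preimage,
    although BC2 only tests it against members of [Cl]: a member [M] of [Bd] that
    [f] maps into [C] misses [neg (g C)] by BC3 and BC1, so it is below [g C].
    The same argument with BC2 and BC3 exchanged handles [neg C]. *)
Lemma preimage_Cl C : Cl C ->
  [/\ Cl (pre C) & pre (neg (@Bd T) C) = neg (@Bd S) (pre C)].
Proof.
move=> CC; have [_ [g [[gCl gadj] bc3 _]]] := bcf.
have [BdN CN _] := neg_complement CC; have BdC := Cl_sub_Bd CC.
have [BdgN gCN gCNT] := neg_complement (gCl _ CC).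
have BdgC := Cl_sub_Bd (gCl _ CC).
have gCf : g C `<=` f @^-1` C.
  move=> x gx; apply: ((gadj _ _ (gCl _ CC) CC).2 (fun _ h => h)).
  by exists x.
have -> : pre C = g C.
  apply/seteqP; split; last exact/sub_preimageP.
  apply: (sub_split dS BdgC BdgN (Bd_preimage BdC) BdgC gCNT).
    exact: subIsetr.
  move=> x [/(preimage_sub BdC) Cx /(bc3 _ CC) Nx].
  by apply: (bottom_sub BdgC); apply: preimage_bottom_sub; rewrite -CN.
split; first exact: gCl.
apply/seteqP; split; last by apply/sub_preimageP => //; exact: bc3.
apply: (sub_split dS BdgC BdgN (Bd_preimage BdN) BdgN gCNT).
  move=> x [/(preimage_sub BdN) Nx /gCf Cx].
  by apply: (bottom_sub BdgN); apply: preimage_bottom_sub; rewrite -CN.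
exact: subIsetr.
Qed.

Lemma preimage_opens V : opens V -> opens (pre V).
Proof. by move=> [C CC <-]; have [? ->] := preimage_Cl CC; exists (pre C). Qed.

Lemma preimage_meetn_opens n (V : 'I_n -> set T) :
  (forall k, opens (V k)) -> finite_meets (@opens S) (pre (meetn V)).
Proof.
move=> oV; exists n, (pre \o V); split.
  by move=> k; exact/preimage_opens/oV.
by rewrite preimage_meetn// => k; exact/opens_Bd/oV.
Qed.

(** * Sets separated by the map *)

(** Disjointness is imposed in the target and covering in the source: the basic
    preimage is a right adjoint, so it transports meets by itself, while it is
    the transport of joins that has to be assumed. *)
Definition separated (V V' : set T) : Prop :=
  [/\ Bd V, Bd V', V `&` V' `<=` bottom (@Bd T) &
      join2 (@Bd S) (pre V) (pre V') = setT].

Lemma separated_neg C : Cl C -> separated (neg (@Bd T) C) C.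
Proof.
move=> CC; have [BdN CN _] := neg_complement CC.
have [CpC preN] := preimage_Cl CC; split=> //; first exact: Cl_sub_Bd.
  by rewrite setIC CN.
by rewrite preN /join2 setUC; have [] := neg_complement CpC.
Qed.

Lemma separated_meetn n (V V' : 'I_n -> set T) :
  (forall k, separated (V k) (V' k)) ->
  separated (meetn V) (joinn (@Bd T) V').
Proof.
move=> VV'.
have BdV k : Bd (V k) by have [] := VV' k.
have BdV' k : Bd (V' k) by have [] := VV' k.
have BdM : Bd (meetn V) by exact: Bd_bigcap.
have BdJ : Bd (joinn (@Bd T) V') by exact: Bd_smallest.
split=> //.
  apply: joinn_meet0 => //; first exact: Bd_smallest.
  move=> k; have [_ _ + _] := VV' k; apply: subset_trans; apply: setSI.
  exact: bigcap_inf.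
apply/seteqP; split=> //.
apply: (@sub_splitn _ _ csS dS n (pre \o V) (pre \o V')).
- by move=> k; have [] := VV' k; split=> //; exact: Bd_preimage.
- exact: csS.1.
- exact: Bd_smallest.
- rewrite -preimage_meetn// => x [_ Mx].
  by apply: sub_gen_smallest; left.
- move=> k x [_ V'x]; apply: sub_gen_smallest; right.
  by apply: preimageS V'x => //; exact: sub_joinn.
Qed.

Lemma separated_finite_meet V :
  finite_meets (@opens T) V -> exists V', separated V V'.
Proof.
move=> [n [U [oU ->]]].
have /choice[U' UU'] k : exists U', separated (U k) U'.
  by have [C CC <-] := oU k; exists C; exact: separated_neg.
by exists (joinn (@Bd T) U'); exact: separated_meetn.
Qed.

(** The [pre (V k)] together with the meet of the [pre (V' k)] cover the source.
    On that meet the preimage of the join is trivial, since the join of the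
    [V k] is disjoint from the meet of the [V' k]. *)
Lemma preimage_joinn n (V V' : 'I_n -> set T) :
  (forall k, separated (V k) (V' k)) ->
  pre (joinn (@Bd T) V) = joinn (@Bd S) (pre \o V).
Proof.
move=> VV'.
have BdV k : Bd (V k) by have [] := VV' k.
have BdV' k : Bd (V' k) by have [] := VV' k.
have BdM : Bd (meetn V') by exact: Bd_bigcap.
have BdJ : Bd (joinn (@Bd T) V) by exact: Bd_smallest.
have BdW : Bd (joinn (@Bd S) (pre \o V)) by exact: Bd_smallest.
apply/seteqP; split; last first.
  apply: joinn_sub; first exact: Bd_preimage.
  by move=> k; apply: preimageS => //; exact: sub_joinn.
apply: (@sub_splitn _ _ csS dS n (pre \o V') (pre \o V)) => //.
- move=> k; have [_ _ _] := VV' k; rewrite /join2 setUC.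
  by split=> //; exact: Bd_preimage.
- exact: Bd_preimage.
- rewrite -preimage_meetn//; apply: preimage_disjoint => //.
  rewrite setIC; apply: joinn_meet0 => //; first exact: Bd_smallest.
  move=> k x [V'x Vx]; have [_ _ + _] := VV' k; apply; split=> //.
  exact: V'x k I.
- by move=> k; apply: subset_trans (@sub_joinn _ _ _ _ k); exact: subIsetr.
Qed.

Lemma preimage_fg_opens V : fg_opens V -> fg_opens (pre V).
Proof.
move=> [n [A [mA ->]]].
have /choice[A' AA'] k : exists A', separated (A k) A'.
  exact/separated_finite_meet/mA.
rewrite (preimage_joinn AA'); exists n, (pre \o A); split=> // k.
by have [m [U [oU /= ->]]] := mA k; exact: preimage_meetn_opens.
Qed.

(** * The basic image *)

Lemma Bd_basic_image M : Bd (basic_image f M).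
Proof. exact: Bd_smallest. Qed.

Lemma basic_imageS M N : M `<=` N -> basic_image f M `<=` basic_image f N.
Proof.
move=> MN; apply: smallest_sub; first exact: Bd_basic_image.
by move=> y Ny; apply: sub_gen_smallest; exact: image_subset MN _ Ny.
Qed.

Lemma sub_preimage_image M : Bd M -> M `<=` pre (basic_image f M).
Proof. by move=> BdM; apply/image_sub_preimage => //; exact: Bd_basic_image. Qed.

Lemma basic_image_joinn n (U : 'I_n -> set S) : (forall k, Bd (U k)) ->
  basic_image f (joinn (@Bd S) U) = joinn (@Bd T) (basic_image f \o U).
Proof.
move=> BdU; have BdJ : Bd (joinn (@Bd T) (basic_image f \o U)).
  exact: Bd_smallest.
apply/seteqP; split; last first.
  apply: joinn_sub; first exact: Bd_basic_image.
  by move=> k; apply: basic_imageS; exact: sub_joinn.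
apply/image_sub_preimage => //; first exact: Bd_smallest.
apply: joinn_sub; first exact: Bd_preimage.
by move=> k; apply/image_sub_preimage => //; exact: sub_joinn.
Qed.

(** With [W] the left-hand side, the partner [V'] is moved across: [U] is below
    [pre W] on [pre V] and below [pre V'] on the rest, so its image is below the
    join of [W] and [V'], and meeting with [V] removes [V']. *)
Lemma basic_image_frobenius U V V' : Bd U -> separated V V' ->
  basic_image f (U `&` pre V) = basic_image f U `&` V.
Proof.
move=> BdU [BdV BdV' VV' cover].
have BdpV := Bd_preimage BdV; have BdpV' := Bd_preimage BdV'.
have BdUV : Bd (U `&` pre V) by exact: Bd_setI.
set W := basic_image f _; have BdW : Bd W by exact: Bd_basic_image.
have BdJ : Bd (join2 (@Bd T) W V') by exact: Bd_smallest.
apply/seteqP; split.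
  rewrite subsetI; split; first by apply: basic_imageS; exact: subIsetl.
  by apply/image_sub_preimage => //; exact: subIsetr.
have UWV' : basic_image f U `<=` join2 (@Bd T) W V'.
  apply/image_sub_preimage => //.
  have BdpJ := Bd_preimage BdJ.
  apply: (sub_split dS BdpV BdpV' BdU BdpJ cover).
    apply: (subset_trans (sub_preimage_image BdUV)).
    by apply: preimageS => // x Wx; apply: sub_gen_smallest; left.
  apply: (subset_trans (@subIsetr _ _ _)).
  by apply: preimageS => // x V'x; apply: sub_gen_smallest; right.
apply: (@subset_trans _ (V `&` join2 (@Bd T) W V')).
  by rewrite setIC; exact: setIS.
apply: meet_join2_sub => //.
exact: subset_trans VV' (bottom_sub BdW).
Qed.

(** * Left adjoints on finitely generated open domains *)

Section LeftAdjoint.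
Hypothesis meets_opens : finite_meets (@opens S) = @opens S.

Lemma basic_open_adjoint : basic_open f ->
  adjoint (@fg_opens S) (@fg_opens T) (basic_image f) pre.
Proof.
move=> [_ oimf]; split.
- move=> _ [n [U [oU ->]]]; rewrite meets_opens in oU.
  rewrite basic_image_joinn; last by move=> k; exact/opens_Bd/oU.
  by apply: joinn_opens_fg_opens => k; exact/oimf/oU.
- exact: preimage_fg_opens.
- by move=> A B /fg_opens_Bd BdA /fg_opens_Bd BdB; exact: image_sub_preimage.
Qed.

Context {h : set S -> set T}.
Hypothesis adjh : adjoint (@fg_opens S) (@fg_opens T) h pre.
Hypothesis frobh : forall (U : set S) (n : nat) (V : 'I_n -> set T),
  opens U -> (forall k, opens (V k)) ->
  h (U `&` pre (meetn V)) = h U `&` meetn V.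

Lemma Bd_left_adjoint U : opens U -> Bd (h U).
Proof.
by have [hfg _ _] := adjh; move=> oU; exact/fg_opens_Bd/hfg/opens_fg_opens.
Qed.

Lemma left_adjoint_clause U n (C D : 'I_n -> set T) :
  opens U -> (forall k, Cl (C k) /\ Cl (D k)) ->
  U `<=` pre (clause (@Bd T) C D) -> h U `<=` clause (@Bd T) C D.
Proof.
move=> oU CD; set W := clause _ C D => UW.
pose nC k := neg (@Bd T) (C k); pose nD k := neg (@Bd T) (D k).
have BdC k := Cl_sub_Bd (CD k).1.
have onC k : opens (nC k) by exists (C k) => //; exact: (CD k).1.
have onD k : opens (nD k) by exists (D k) => //; exact: (CD k).2.
have BdnC k : Bd (nC k) by exact/opens_Bd/onC.
have BdnD k : Bd (nD k) by exact/opens_Bd/onD.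
have BdM : Bd (meetn nC) by exact: Bd_bigcap.
have BdW : Bd W by exact: Bd_smallest.
have BdJ : Bd (joinn (@Bd T) nD) by exact: Bd_smallest.
have CW k : C k `<=` W.
  apply: subset_trans (@sub_joinn _ _ _ _ k).
  by move=> x Cx; apply: sub_gen_smallest; left.
have DW k : nD k `<=` W.
  apply: subset_trans (@sub_joinn _ _ _ _ k).
  by move=> x Dx; apply: sub_gen_smallest; right.
have MWJ : meetn nC `&` W `<=` joinn (@Bd T) nD.
  apply: joinn_meet0 => //; first by move=> k; exact: Bd_smallest.
  move=> k; apply: meet_join2_sub => //; first exact: BdnD.
    move=> x [Mx Cx]; have [_ CN _] := neg_complement (CD k).1.
    by apply: (bottom_sub BdJ); rewrite -CN; split=> //; exact: Mx k I.
  by apply: subset_trans (@sub_joinn _ _ _ _ k); exact: subIsetr.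
have hUM : h U `&` meetn nC `<=` joinn (@Bd T) nD.
  have oUM : opens (U `&` pre (meetn nC)).
    rewrite -meets_opens; apply: finite_meets_setI => //.
    by rewrite -meets_opens; exact: preimage_meetn_opens.
  rewrite -frobh//; have [_ _ hP] := adjh.
  apply/hP; first exact: opens_fg_opens.
    exact: joinn_opens_fg_opens.
  apply/sub_preimageP => //; first exact: opens_Bd.
  move=> x [/UW Wx Mx]; apply: MWJ.
  by split; [exact: preimage_sub Mx|exact: preimage_sub Wx].
apply: (@sub_splitn _ _ (@Bd_closure_system T) dT n nC C) => //.
- move=> k; have [_ _] := neg_complement (CD k).1.
  by rewrite /join2 setUC.
- exact: Bd_left_adjoint.
- by apply: (subset_trans hUM); exact: joinn_sub.
- by move=> k; apply: subset_trans (CW k); exact: subIsetr.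
Qed.

Lemma left_adjoint_image U : opens U -> h U = basic_image f U.
Proof.
move=> oU; have BdU := opens_Bd oU; have [hfg _ hP] := adjh.
have fgU := opens_fg_opens oU.
apply/seteqP; split; last first.
  apply/image_sub_preimage => //; first exact: Bd_left_adjoint.
  by apply/hP => //; exact: hfg.
have BdI := Bd_basic_image U.
have [J [n [C [D [CD defI]]]]] := Bd_generated BdI.
rewrite defI => y hUy i _.
apply: left_adjoint_clause hUy => //.
apply/image_sub_preimage => //; first exact: Bd_smallest.
by rewrite defI => z; exact.
Qed.

End LeftAdjoint.

End Preimage.

Unset Implicit Arguments.
Set Strict Implicit.

Theorem theorem8p4 (S T : b0space) (f : S -> T) :
  finite_meets (@opens S) = @opens S ->
  basic_continuous f ->
  basic_open f <->
  exists h : set S -> set T,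
    [/\ adjoint (@fg_opens S) (@fg_opens T) h (basic_preimage f),
        forall U : set S, opens U -> opens (h U) &
        forall (U : set S) (n : nat) (V : 'I_n -> set T),
          opens U -> (forall k, opens (V k)) ->
          h (U `&` basic_preimage f (meetn V)) = h U `&` meetn V].
Proof.
move=> meets_opens bcf; split=> [openf|[h [adjh oh frobh]]]; last first.
  split=> // U oU.
  by rewrite -(left_adjoint_image bcf meets_opens adjh frobh)//; exact: oh.
exists (basic_image f); split.
- exact: basic_open_adjoint.
- exact: openf.2.
- move=> U n V oU oV.
  have [V' VV'] : exists V', separated (f := f) (meetn V) V'.
    by apply: separated_finite_meet => //; exists n, V.
  by apply: (basic_image_frobenius bcf) VV'; exact: opens_Bd.
Qed.
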